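(* Let $m,n\ge 0$ be integers with $m+n\ge 1$, let $q=e^{h}$ be a complex number with $q\neq -1$, and let $F(n|m)$ be the Fock space of the deformed Clifford superalgebra $Cl_q(n|m)$, with basis $|r_1,\ldots,r_{m+n}\rangle=(c_1^+)^{r_1}\cdots(c_{m+n}^+)^{r_{m+n}}|0\rangle$, where $r_i\in\mathbb{Z}_{\ge 0}$ for $1\le i\le m$ and $r_i\in\{0,1\}$ for $m+1\le i\le m+n$. Then for every $i=1,\ldots,m+n$ and every basis vector $$N_i|r_1,\ldots,r_{m+n}\rangle=r_i|r_1,\ldots,r_{m+n}\rangle,$$ $$c_i^+|r_1,\ldots,r_{m+n}\rangle=(-1)^{(1-\langle i\rangle)(r_1+\cdots+r_{i-1})}\bigl(1-(1-\langle i\rangle)r_i\bigr)\,q^{-(r_1+\cdots+r_{i-1})}\,|r_1,\ldots,r_{i-1},r_i+1,r_{i+1},\ldots,r_{m+n}\rangle,$$ $$c_i^-|r_1,\ldots,r_{m+n}\rangle=(-1)^{(1-\langle i\rangle)(r_1+\cdots+r_{i-1})}\,[r_i]\,c_q\,q^{r_1+\cdots+r_{i-1}}\,|r_1,\ldots,r_{i-1},r_i-1,r_{i+1},\ldots,r_{m+n}\rangle,$$ where a term whose scalar coefficient vanishes is read as $0$.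
   Context: Notation: $\langle i\rangle=1$ for $i\le m$ and $\langle i\rangle=0$ for $i>m$; $[x]=\frac{q^x-q^{-x}}{q-q^{-1}}$ (read as $x$ if $q=1$); $q^{\pm1/2}=e^{\pm h/2}$; $c_q=\frac{2}{q^{1/2}+q^{-1/2}}$. The deformed Clifford superalgebra $Cl_q(n|m)$ is the associative unital superalgebra with generators $c_i^\pm$, $N_i$ ($i=1,\ldots,m+n$), of degrees $\deg(c_i^\pm)=\langle i\rangle$, $\deg(N_i)=0$ in $\mathbb{Z}_2$, and relations - $[N_i,N_j]=0$, $[N_i,c_j^\pm]=\pm\delta_{ij}c_j^\pm$; - $c_i^-c_i^+ +(-1)^{\langle i\rangle}q^{\pm1}c_i^+c_i^-=c_q\,q^{\pm(-1)^{\langle i\rangle}N_i}$ (both signs), equivalently $c_i^+c_i^-=c_q[N_i]$ and $c_i^-c_i^+=c_q[1-(-1)^{\langle i\rangle}N_i]$; - $c_i^\xi c_j^\eta=-(-1)^{\langle j\rangle}q^{\xi\eta}c_j^\eta c_i^\xi$ for all $i<j$ and $\xi,\eta=\pm$ (identified with $\pm1$); - $(c_i^\pm)^2=0$ for $i=m+1,\ldots,m+n$. For complex $q=e^h$, a $Cl_q(n|m)$-module is a complex vector space with operators $c_i^\pm$ and diagonalizable $N_i$ satisfying these relations, with $q^{\pm N_i}=e^{\pm hN_i}$. The Fock space $F(n|m)$ is the $Cl_q(n|m)$-module generated by a vacuum vector $|0\rangle$ with $c_i^-|0\rangle=0$ and $N_i|0\rangle=0$ for all $i$, in which the vectors $|r_1,\ldots,r_{m+n}\rangle$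 given in the claim form a basis. *)

(* Defs.v *)
(* MathComp / MathComp-Analysis: the complex numbers are R[i] for R : realType. *)
From HB Require Import structures.
From mathcomp Require Import all_boot all_order all_algebra.
From mathcomp Require Import complex.
From mathcomp Require Import reals sequences exp trigo.
Set Implicit Arguments.
Unset Strict Implicit.
Unset Printing Implicit Defensive.
Import Order.TTheory GRing.Theory Num.Theory.
Local Open Scope ring_scope.
Local Open Scope complex_scope.

Definition cexp (R : realType) (z : R[i]) : R[i] :=
  (expR (complex.Re z))%:C *
  (cos (complex.Im z) +i* sin (complex.Im z)).

(* [x] = (q^x - q^-x) / (q - q^-1) where q = e^h and q^x = e^(h x). *)
Definition qnum (R : realType) (h x : R[i]) : R[i] :=
  if cexp h == 1 then x
  else (cexp (h * x) - cexp (- (h * x))) / (cexp h - cexp (- h)).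

(* c_q = 2 / (q^(1/2) + q^(-1/2)) where q^(1/2) stands for e^(h/2): it depends
   on h, not only on q = e^h. *)
Definition c_q (R : realType) (h : R[i]) : R[i] :=
  2 / (cexp (h / 2) + cexp (- (h / 2))).

(* The symbols <i>, with indices counted from 0. *)
Definition ang (m k : nat) : nat := (k < m)%N.

(* The two signs are encoded as booleans, true for + and false for -. *)
Definition sg (s : bool) : int := if s then 1 else - 1.

Definition diagonalizable_op (R : realType) (V : lmodType R[i])
    (N : {linear V -> V}) : Prop :=
  forall v : V, exists s : seq V,
    (forall u, u \in s -> exists l : R[i], N u = l *: u) /\
    v = \sum_(u <- s) u.

(* K = e^(z N).  When N is diagonalizable, such a K exists and is unique. *)
Definition is_exp_op (R : realType) (V : lmodType R[i]) (z : R[i])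
    (N K : {linear V -> V}) : Prop :=
  forall (l : R[i]) (v : V), N v = l *: v -> K v = cexp (z * l) *: v.

(* Modules over Cl_q(n|m), q = e^h: [c true i], [c false i] and [N i] are the
   operators c_i^+, c_i^- and N_i. *)
Record is_Cl_module (R : realType) (m n : nat) (h : R[i]) (V : lmodType R[i])
    (c : bool -> 'I_(m + n) -> {linear V -> V})
    (N : 'I_(m + n) -> {linear V -> V}) : Prop := IsClModule {
  Cl_N_diag : forall i, diagonalizable_op (N i);
  Cl_NN : forall i j v, N i (N j v) - N j (N i v) = 0;
  Cl_Nc : forall i j s v,
    N i (c s j v) - c s j (N i v) = ((sg s)%:~R * (i == j)%:R) *: c s j v;
  Cl_cc_same : forall (i : 'I_(m + n)) s,
    exists2 K : {linear V -> V},
      is_exp_op ((sg s)%:~R * (-1) ^+ ang m i * h) (N i) K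
    & forall v, c false i (c true i v)
                + ((-1) ^+ ang m i * cexp h ^ sg s) *: c true i (c false i v)
              = c_q h *: K v;
  Cl_cc_diff : forall (i j : 'I_(m + n)) xi eta v, (i < j)%N ->
    c xi i (c eta j v) =
    (- (-1) ^+ ang m j * cexp h ^ (sg xi * sg eta)) *: c eta j (c xi i v);
  Cl_cc_nil : forall (i : 'I_(m + n)) s v, (m <= i)%N -> c s i (c s i v) = 0
}.

Definition is_Cl_submodule (R : realType) (k : nat) (V : lmodType R[i])
    (c : bool -> 'I_k -> {linear V -> V}) (N : 'I_k -> {linear V -> V})
    (S : V -> Prop) : Prop :=
  [/\ S 0,
      forall (a : R[i]) u v, S u -> S v -> S (a *: u + v),
      forall s i v, S v -> S (c s i v)
    & forall i v, S v -> S (N i v)].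

Definition admissible (m n : nat) (r : {ffun 'I_(m + n) -> nat}) : Prop :=
  forall i : 'I_(m + n), (m <= i)%N -> (r i <= 1)%N.

(* |r_1, ..., r_k> = (c_1^+)^(r_1) ... (c_k^+)^(r_k) |0>, c_1^+ outermost. *)
Definition ket (R : realType) (k : nat) (V : lmodType R[i])
    (c : bool -> 'I_k -> {linear V -> V}) (vac : V)
    (r : {ffun 'I_k -> nat}) : V :=
  foldr (fun i v => iter (r i) (c true i) v) vac (enum 'I_k).

(* The family (b x), x ranging over P, is a basis of V in the algebraic sense. *)
Definition is_basis (F : fieldType) (V : lmodType F) (I : eqType)
    (P : I -> Prop) (b : I -> V) : Prop :=
  (forall (s : seq I) (a : I -> F), uniq s -> (forall x, x \in s -> P x) ->
     \sum_(x <- s) a x *: b x = 0 -> forall x, x \in s -> a x = 0) /\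
  (forall v : V, exists (s : seq I) (a : I -> F),
     (forall x, x \in s -> P x) /\ v = \sum_(x <- s) a x *: b x).

Record is_Fock_space (R : realType) (m n : nat) (h : R[i]) (V : lmodType R[i])
    (c : bool -> 'I_(m + n) -> {linear V -> V})
    (N : 'I_(m + n) -> {linear V -> V}) (vac : V) : Prop := IsFockSpace {
  Fock_module : is_Cl_module h c N;
  Fock_c_vac : forall i, c false i vac = 0;
  Fock_N_vac : forall i, N i vac = 0;
  Fock_generated : forall S : V -> Prop,
    is_Cl_submodule c N S -> S vac -> forall v, S v;
  Fock_basis : is_basis (@admissible m n) (ket c vac)
}.

(* r with the entry r_i replaced by k. *)
Definition upd (p : nat) (r : {ffun 'I_p -> nat}) (i : 'I_p) (k : nat) :
    {ffun 'I_p -> nat} :=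
  [ffun j => if j == i then k else r j].

Definition presum (p : nat) (r : {ffun 'I_p -> nat}) (i : 'I_p) : nat :=
  (\sum_(j < p | j < i) r j)%N.

(* Main.v *)
(* Write the ket as (product over j < i) (c_i^+)^(r_i) w with w the product over
   j > i applied to the vacuum.  Moving c_i^(+/-) through the left factors
   costs a power of -(-1)^<i> q^(-/+1).  Moreover N_i w = 0 and c_i^- w = 0, and
   the recursion a_(k+1) = q^(-k) + q a_k read off from the same-index relation
   gives c_i^- (c_i^+)^k w = [k] c_q (c_i^+)^(k-1) w; for i > m only k <= 1 occurs,
   where the sign in that relation is immaterial. *)
Require Import Defs.
From HB Require Import structures.
From mathcomp Require Import all_boot all_order all_algebra.
From mathcomp Require Import complex.
From mathcomp Require Import reals sequences exp trigo.
From mathcomp Require Import ring.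
Set Implicit Arguments.
Unset Strict Implicit.
Unset Printing Implicit Defensive.
Import Order.TTheory GRing.Theory Num.Theory.
Local Open Scope ring_scope.
Local Open Scope complex_scope.

Section ComplexExponential.
Variable R : realType.
Implicit Types z w h : R[i].

Lemma cexp0 : cexp (0 : R[i]) = 1.
Proof. by rewrite /cexp /= expR0 cos0 sin0 mul1r. Qed.

Lemma cexpD z w : cexp (z + w) = cexp z * cexp w.
Proof.
rewrite /cexp; case: z w => [a b] [a' b'] /=.
rewrite expRD cosD sinD; simpc; congr (_ +i* _); ring.
Qed.

Lemma cexp_neq0 z : cexp z != 0.
Proof.
apply/eqP => z0; have /eqP := cexpD z (- z).
by rewrite subrr cexp0 z0 mul0r oner_eq0.
Qed.

Lemma cexpN z : cexp (- z) = (cexp z)^-1.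
Proof.
apply: (mulfI (cexp_neq0 z)).
by rewrite -cexpD subrr cexp0 mulfV ?cexp_neq0.
Qed.

Lemma cexpM_nat z k : cexp (z * k%:R) = cexp z ^+ k.
Proof.
elim: k => [|k IHk]; first by rewrite mulr0 cexp0.
by rewrite -natr1 mulrDr mulr1 cexpD IHk exprSr.
Qed.

Lemma qnum0 h : qnum h 0 = 0.
Proof. by rewrite /qnum mulr0 oppr0 subrr mul0r if_same. Qed.

(** For q = 1 this is k+1 = 1+k. Otherwise multiply by q - q^-1, which is nonzero because q (q -
    q^-1) = (q-1)(q+1), and expand: q^(k+1) - q^-(k+1) = q^-k (q - q^-1) + q (q^k - q^-k). *)
Lemma qnumS h k : cexp h <> -1 ->
  qnum h k.+1%:R = cexp h ^- k + cexp h * qnum h k%:R.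
Proof.
move=> hN1; rewrite /qnum !cexpN !cexpM_nat.
have [->|h1] := eqVneq (cexp h) 1.
  by rewrite expr1n invr1 mul1r -natr1 addrC.
have q0 := cexp_neq0 h.
have qV : cexp h - (cexp h)^-1 != 0.
  rewrite -(mulrI_eq0 _ (mulfI q0)) mulrBr mulfV // -expr2 subr_sqr_1.
  rewrite mulf_neq0 ?subr_eq0 // addr_eq0; exact/eqP.
apply: (mulIf qV); rewrite [RHS]mulrDl -[cexp h * _ * _]mulrA !divfK //.
by rewrite exprS invfM; ring.
Qed.

End ComplexExponential.

Section LinearIteration.
Variables (K : fieldType) (V : lmodType K).

Lemma iter_linear_comm (A B : {linear V -> V}) (x : K) k v :
  (forall u, A (B u) = x *: B (A u)) ->
  A (iter k B v) = x ^+ k *: iter k B (A v).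
Proof.
move=> AB; elim: k => [|k IHk]; first by rewrite scale1r.
by rewrite !iterS AB IHk linearZ_LR scalerA exprS.
Qed.

Lemma iter_linearZ (B : {linear V -> V}) (a : K) k v :
  iter k B (a *: v) = a *: iter k B v.
Proof. by elim: k => //= k ->; rewrite linearZ_LR. Qed.

Variables (I : eqType) (b : I -> {linear V -> V}) (r : I -> nat).

(** The same fold as in [ket], but over an arbitrary list, so that a ket can be cut at a given
    index. *)
Definition monomial (s : seq I) (v : V) :=
  foldr (fun j u => iter (r j) (b j) u) v s.

Lemma monomialZ s a v : monomial s (a *: v) = a *: monomial s v.
Proof. by elim: s => //= j s ->; rewrite iter_linearZ. Qed.

Lemma monomial0 s : monomial s 0 = 0.
Proof. by rewrite -[X in monomial _ X](scale0r 0) monomialZ scale0r. Qed.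

Lemma monomial_comm (A : {linear V -> V}) (x : I -> K) s v :
  (forall j u, j \in s -> A (b j u) = x j *: b j (A u)) ->
  A (monomial s v) = (\prod_(j <- s) x j ^+ r j) *: monomial s (A v).
Proof.
elim: s => [|j s IHs] As /=; first by rewrite big_nil scale1r.
rewrite (@iter_linear_comm _ _ (x j)); last by move=> u; rewrite As ?mem_head.
rewrite IHs; last by move=> l u ls; rewrite As // inE ls orbT.
by rewrite iter_linearZ scalerA big_cons.
Qed.

(** Used for the indices after [i], with [A] equal to N_i or c_i^- and [v] the vacuum. *)
Lemma monomial_killed (A : {linear V -> V}) (x : I -> K) s v :
  (forall j u, j \in s -> A (b j u) = x j *: b j (A u)) ->
  A v = 0 -> A (monomial s v) = 0.
Proof.
by move=> /monomial_comm -> ->; rewrite monomial0 scaler0.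
Qed.

End LinearIteration.

Lemma eq_monomial (K : fieldType) (V : lmodType K) (I : eqType)
    (b : I -> {linear V -> V}) (r r' : I -> nat) s v :
  {in s, r =1 r'} -> monomial b r s v = monomial b r' s v.
Proof.
elim: s => //= j s IHs rr'; rewrite rr' ?mem_head // IHs // => l ls.
by rewrite rr' // inE ls orbT.
Qed.

Lemma enum_ord_split p (i : 'I_p) : exists s1 s2 : seq 'I_p,
  [/\ enum 'I_p = s1 ++ i :: s2,
      forall j, j \in s1 -> (j < i)%N
    & forall j, j \in s2 -> (i < j)%N].
Proof.
(* Pairwise order, unlike sortedness of neighbours, compares [i] directly with every element on
   either side of a cut. *)
have : pairwise (fun j l : 'I_p => j < l)%N (enum 'I_p).
  have : sorted ltn (map val (enum 'I_p)) by rewrite val_enum_ord iota_ltn_sorted.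
  rewrite sorted_pairwise; last exact: ltn_trans.
  by rewrite pairwise_map.
have : i \in enum 'I_p by rewrite mem_enum.
case/splitPr => s1 s2; rewrite pairwise_cat /= => /and3P[s1s2 _ /andP[is2 _]].
exists s1, s2; split=> // j js; last exact: (allP is2).
by move/allrelP: s1s2; apply; rewrite ?mem_head.
Qed.

Lemma presum_split p (r : {ffun 'I_p -> nat}) (i : 'I_p) s1 s2 :
  enum 'I_p = s1 ++ i :: s2 -> (forall j, j \in s1 -> (j < i)%N) ->
  (forall j, j \in s2 -> (i < j)%N) -> presum r i = (\sum_(j <- s1) r j)%N.
Proof.
move=> E lt1 lt2.
rewrite /presum big_mkcond -big_enum /= E big_cat big_cons /= ltnn add0n.
rewrite [X in (_ + X)%N]big1_seq ?addn0 => [|j /lt2 ij]; last first.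
  by rewrite ltnNge ltnW.
by apply: eq_big_seq => j /lt1 ->.
Qed.

Section FockSpace.
Variables (R : realType) (m n : nat) (h : R[i]).
Hypothesis hq : cexp h <> -1.
Variables (V : lmodType R[i]) (c : bool -> 'I_(m + n) -> {linear V -> V}).
Variables (N : 'I_(m + n) -> {linear V -> V}).
Hypothesis hM : is_Cl_module h c N.
Implicit Types (i j : 'I_(m + n)) (v w : V).

Lemma N_iter_same i k v (l : R[i]) : N i v = l *: v ->
  N i (iter k (c true i) v) = (l + k%:R) *: iter k (c true i) v.
Proof.
move=> Nv; elim: k => [|k IHk]; first by rewrite addr0.
have /eqP := Cl_Nc hM i i true (iter k (c true i) v).
rewrite subr_eq eqxx !mulr1 -iterS => /eqP ->.
by rewrite IHk linearZ_LR iterS -scalerDl addrC -addrA natr1.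
Qed.

(** The factor 1 gives commutation the form expected by [monomial_comm]. *)
Lemma N_comm_neq i j s v : i != j -> N i (c s j v) = 1 *: c s j (N i v).
Proof.
move=> /negPf ij; have /eqP := Cl_Nc hM i j s v.
by rewrite ij mulr0 scale0r subr_eq0 scale1r => /eqP.
Qed.

(** The defining relation has the smaller index on the left, so here it is inverted: applied on the
    right-hand side, its scalar cancels, since -(-1)^<i> = (-1)^(1-<i>) is its own inverse. *)
Lemma cc_comm_lt i j s v : (j < i)%N ->
  c s i (c true j v) =
  ((-1) ^+ (1 - ang m i) * cexp h ^ (- sg s)) *: c true j (c s i v).
Proof.
move=> ji; rewrite (Cl_cc_diff hM _ _ _ ji) scalerA mulrACA.
have -> : sg true * sg s = sg s by rewrite mul1r.
rewrite -expfzDr ?cexp_neq0 // addNr expr0z mulr1 /ang.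
by case: (i < m)%N; rewrite /= ?expr0 ?expr1 ?mul1r ?mulrNN ?mul1r ?opprK scale1r.
Qed.

Lemma cc_comm_gt i j s v : (i < j)%N ->
  c s i (c true j v) =
  (- (-1) ^+ ang m j * cexp h ^ sg s) *: c true j (c s i v).
Proof. by move=> ij; rewrite (Cl_cc_diff hM _ _ _ ij) mulr1. Qed.

Lemma annihilation_iter i k w : N i w = 0 -> c false i w = 0 ->
  (m <= i -> k <= 1)%N ->
  c false i (iter k (c true i) w) =
  (qnum h k%:R * c_q h) *: iter k.-1 (c true i) w.
Proof.
move=> Nw cw; elim: k => [|k IHk] km; first by rewrite qnum0 mul0r scale0r.
have Nk : N i (iter k (c true i) w) = k%:R *: iter k (c true i) w.
  by rewrite (@N_iter_same i k w 0) ?add0r // Nw scale0r.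
(* The upper-sign relation is used; by [Nk], K = q^((-1)^<i> N_i) acts on this vector as the scalar
   q^((-1)^<i> k). *)
have [K Kexp cc] := Cl_cc_same hM i true.
move/eqP: (cc (iter k (c true i) w)); rewrite (Kexp _ _ Nk) -iterS.
rewrite -subr_eq0 -addrA addr_eq0 => /eqP ->.
(* Applying c_i^+ restores the exponent from [k.-1] to k; for k = 0, where [k.-1] is again 0, both
   sides vanish because [0] = 0. *)
have {}IHk : c true i (c false i (iter k (c true i) w)) =
    (qnum h k%:R * c_q h) *: iter k (c true i) w.
  rewrite IHk => [|mi]; last exact: ltnW (km mi).
  by case: (k) => [|k']; rewrite ?qnum0 ?mul0r ?scale0r ?linear0 // linearZ_LR.
rewrite IHk !scalerA -scalerBl -scaleNr opprB.
have [im|mi] := ltnP i m.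
  rewrite /ang im expr1 mul1r mulN1r !mulNr mul1r cexpN cexpM_nat expr1z qnumS //.
  by congr (_ *: _); ring.
(* For <i> = 0 the bound k+1 <= 1 leaves only the first step, where both sides reduce to c_q w. *)
have -> : k = 0%N by apply/eqP; rewrite -leqn0 -ltnS km.
rewrite qnumS // qnum0 mulr0 cexp0 expr0 invr1.
by congr (_ *: _); ring.
Qed.

End FockSpace.

Theorem proposition1 (R : realType) (m n : nat) (hmn : (1 <= m + n)%N)
    (h : R[i]) (hq : cexp h <> -1)
    (V : lmodType R[i])
    (c : bool -> 'I_(m + n) -> {linear V -> V})
    (N : 'I_(m + n) -> {linear V -> V}) (vac : V)
    (hF : is_Fock_space h c N vac)
    (i : 'I_(m + n)) (r : {ffun 'I_(m + n) -> nat}) (hr : admissible r) :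
  [/\ N i (ket c vac r) = (r i)%:R *: ket c vac r,
      c true i (ket c vac r) =
        ((-1) ^+ ((1 - ang m i) * presum r i)
         * (1 - (1 - (ang m i)%:R) * (r i)%:R)
         * cexp h ^- presum r i)
        *: ket c vac (upd r i (r i).+1)
    & c false i (ket c vac r) =
        ((-1) ^+ ((1 - ang m i) * presum r i)
         * qnum h (r i)%:R * c_q h
         * cexp h ^+ presum r i)
        *: ket c vac (upd r i (r i).-1)].
Proof.
have hM := Fock_module hF.
have [s1 [s2 [E lt1 lt2]]] := enum_ord_split i.
set w := monomial (c true) r s2 vac.
have Nw : N i w = 0.
  apply: (@monomial_killed _ _ _ _ _ _ (fun=> 1)) (Fock_N_vac hF i) => j u /lt2 ij.
  by rewrite (N_comm_neq hM) // lt_eqF.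
have cw : c false i w = 0.
  pose x (j : 'I_(m + n)) := - (-1) ^+ ang m j * cexp h ^ sg false.
  apply: (@monomial_killed _ _ _ _ _ _ x) (Fock_c_vac hF i) => j u /lt2.
  exact: (cc_comm_gt hM).
(* Neither [s1] nor [s2] contains [i], so changing the entry at [i] alters only the exponent of
   c_i^+; all kets in the statement share the same outer product and the same [w]. *)
have ketE k : ket c vac (upd r i k) =
    monomial (c true) r s1 (iter k (c true i) w).
  rewrite /ket E foldr_cat /= ffunE eqxx.
  rewrite -/(monomial _ _ _ _) -/(monomial _ _ _ _).
  rewrite (@eq_monomial _ _ _ _ _ r) => [|j /lt1 ji]; last first.
    by rewrite ffunE -val_eqE ltn_eqF.
  congr (monomial _ _ _ (iter _ _ _)); apply: eq_monomial => j /lt2 ij.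
  by rewrite ffunE -val_eqE gtn_eqF.
have updE : upd r i (r i) = r.
  by apply/ffunP => j; rewrite ffunE; case: eqP => [->|].
have left_comm s v : c s i (monomial (c true) r s1 v) =
    ((-1) ^+ (1 - ang m i) * cexp h ^ (- sg s)) ^+ presum r i
      *: monomial (c true) r s1 (c s i v).
  (* The scalar [x] is the same for every j < i, so the product of the x^(r_j) collapses to one
     power with exponent r_1 + ... + r_(i-1). *)
  set x := (_ * cexp h ^ _); rewrite (presum_split r E lt1 lt2) -prodrXr.
  apply: (@monomial_comm _ _ _ _ _ _ (fun=> x)) => j u /lt1.
  exact: (cc_comm_lt hM).
have rE : ket c vac r = monomial (c true) r s1 (iter (r i) (c true i) w).
  by rewrite -ketE updE.
split.
- rewrite rE (@monomial_comm _ _ _ _ _ _ (fun=> 1)) => [|j u /lt1 ji]; last first.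
    by rewrite (N_comm_neq hM) // gt_eqF.
  rewrite (@N_iter_same _ _ _ _ _ _ _ hM i _ w 0) ?scale0r // add0r monomialZ.
  by rewrite prodrXr expr1n scale1r.
- rewrite rE ketE left_comm -iterS exprMn -exprM exprN1 exprVn.
  have [im|mi] := ltnP i m; first by rewrite /ang im subrr mul0r subr0 mulr1.
  have /= := hr i mi; rewrite /ang ltnNge mi subr0 mul1r.
  (* For <i> = 0 and r_i = 1 the coefficient 1 - r_i vanishes, matching (c_i^+)^2 = 0. *)
  case: (r i) => [|[|//]] _; first by rewrite subr0 mulr1.
  by rewrite subrr mulr0 mul0r scale0r /= (Cl_cc_nil hM) // monomial0 scaler0.
- rewrite rE ketE left_comm (annihilation_iter hq hM) // => [|mi]; last exact: hr.
  rewrite monomialZ scalerA opprK exprMn -exprM expr1z.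
  by congr (_ *: _); ring.
Qed.
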